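(* Let $n\ge 1$ be an integer with $6\nmid n$, let $D_{2n}=\langle \sigma,\tau \mid \sigma^n=\tau^2=e,\ \tau\sigma\tau=\sigma^{-1}\rangle$ be the dihedral group of order $2n$, and let $X=X(D_{2n},S)$ be its Cayley graph with $S=\{\sigma,\tau\}$. Then, as abelian groups, \[ \mathcal{BF}(X)\cong\begin{cases}\{1\} & \text{if } n\equiv\pm1\pmod 6,\\ \mathbb{Z}/3\mathbb{Z} & \text{if } n\equiv\pm2\pmod 6,\\ \mathbb{Z}/2\mathbb{Z}\times\mathbb{Z}/2\mathbb{Z} & \text{if } n\equiv 3\pmod 6.\end{cases} \]
   Context: For a group $G$ and a generating set $S$ of $G$, the (directed) Cayley graph $X(G,S)$ has vertex set $G$ and, for every $g\in G$ and $s\in S$, one directed edge from $g$ to $gs$ (loops and multiple edges allowed). For a finite digraph $X$ with $N$ vertices $v_1,\dots,v_N$, the adjacency matrix $A_X=[a_{ij}]$ has $a_{ij}$ equal to the number of edges from $v_i$ to $v_j$. The Bowen--Franks group is $\mathcal{BF}(X)=\operatorname{coker}(\mathrm{Id}-A_X)=\mathbb{Z}^N/(\mathrm{Id}-A_X)\mathbb{Z}^N$. *)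

(* Defs.v *)
From HB Require Import structures.
From mathcomp Require Import all_boot all_order all_algebra all_fingroup.
From mathcomp Require Import boolp.

Set Implicit Arguments.
Unset Strict Implicit.
Unset Printing Implicit Defensive.

Import GRing.Theory.

(* Finite digraphs with loops and multiple edges. *)
Record digraph := Digraph {
  vertex : finType;
  edge : finType;
  source : edge -> vertex;
  target : edge -> vertex }.

Definition adjacency (X : digraph) : 'M[int]_#|vertex X| :=
  \matrix_(i, j) Posz #|[set e : edge X |
    (source e == enum_val i) && (target e == enum_val j)]|.

Section Cokernel.
Local Open Scope ring_scope.
Variables (m n : nat) (M : 'M[int]_(m, n)).

Definition im_mx : {pred 'cV[int]_m} :=
  fun v => `[< exists w : 'cV[int]_n, v = M *m w >].

Fact im_mx_zmod_closed : zmod_closed im_mx.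
Proof.
split; first by apply/asboolP; exists 0; rewrite mulmx0.
move=> u v /asboolP[x ->] /asboolP[y ->].
by apply/asboolP; exists (x - y); rewrite mulmxBr.
Qed.

HB.instance Definition _ :=
  GRing.isZmodClosed.Build 'cV[int]_m im_mx im_mx_zmod_closed.

Definition coker_mx : zmodType := Quotient.quot im_mx.
End Cokernel.

Definition bowen_franks (X : digraph) : zmodType :=
  coker_mx (1%:M - adjacency X)%R.

Definition zmod_isog (A B : zmodType) : Prop :=
  exists f : {additive A -> B}, bijective f.

Definition cayley_digraph (gT : finGroupType) (S : {set gT}) : digraph :=
  @Digraph gT (gT * {x : gT | x \in S})%type
    (fun e => e.1) (fun e => (e.1 * val e.2)%g).

Section Dihedral.
Local Open Scope group_scope.

Definition dihedral_rel (n : nat) (G : groupType) (s t : G) : Prop :=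
  [/\ s ^+ n = 1, t ^+ 2 = 1 & t * s * t = s^-1].

(* gT is presented by < s, t | s^n = t^2 = 1, t s t = s^-1 >: s and t generate
   gT, satisfy the relations, and any pair satisfying them in any group (not
   necessarily finite) is the image of (s, t) under a morphism. *)
Definition dihedral_presentation (n : nat) (gT : finGroupType) (s t : gT) :
    Prop :=
  [/\ <<[set s; t]>> = [set: gT],
      dihedral_rel n s t &
      forall (H : groupType) (a b : H), dihedral_rel n a b ->
        exists f : {multiplicative gT -> H}, f s = a /\ f t = b].

End Dihedral.

(* A model on Z/n x bool, the pair (i, b) standing for s^i t^b; it shows that
   dihedral_presentation is satisfiable, by a group of order 2n. *)
Section DihedralModel.
Variable m : nat.
Definition dih : Type := ('I_m.+1 * bool)%type.
HB.instance Definition _ := Finite.on dih.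
Local Open Scope ring_scope.
Definition sg (b : bool) (i : 'I_m.+1) := if b then - i else i.
Definition dmul (x y : dih) : dih := (x.1 + sg x.2 y.1, x.2 (+) y.2).
Definition dinv (x : dih) : dih := (sg (~~ x.2) x.1, x.2).
Lemma dmulA : associative dmul.
Proof.
move=> [i a] [j b] [k c]; rewrite /dmul /= addbA; congr (_, _).
by case: a; case: b; rewrite /= ?opprD ?opprK addrA.
Qed.
Lemma dmul1 : left_id ((0, false) : dih) dmul.
Proof. by case=> i b; rewrite /dmul /= add0r. Qed.
Lemma dmulV : left_inverse ((0, false) : dih) dinv dmul.
Proof. by case=> i [|]; rewrite /dmul /= ?subrr ?addNr. Qed.
HB.instance Definition _ := Finite_isGroup.Build dih dmulA dmul1 dmulV.
End DihedralModel.

Local Open Scope group_scope.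
Lemma dihedral_presentation_exists (n : nat) : (0 < n)%N ->
  exists (gT : finGroupType) (s t : gT),
    dihedral_presentation n s t /\ #|gT| = (2 * n)%N.
Proof.
case: n => // m _; pose G : finGroupType := dih m.
pose s : G := (inZp 1, false); pose t : G := (0%R, true).
have sX k : s ^+ k = (inZp k, false) :> G.
  elim: k => [|k IH]; first by congr (_, _); apply: val_inj; rewrite /= mod0n.
  rewrite expgSr IH; congr (_, _); apply: val_inj.
  by rewrite /= modnDml modnDmr addn1.
have E (x : G) : x = s ^+ x.1 * t ^+ x.2.
  rewrite sX; case: x => i b; have -> : t ^+ b = (0%R, b) by case: b.
  by congr (_, _); rewrite /= addr0 valZpK.
exists G, s, t; split; last by rewrite card_prod card_ord card_bool mulnC.
split.
- apply/eqP; rewrite eqEsubset subsetT /=; apply/subsetP => x _.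
  by rewrite (E x) groupM // groupX // mem_gen // !inE eqxx ?orbT.
- split; first by rewrite sX; congr (_, _); apply: val_inj; rewrite /= modnn.
    by congr (_, _); rewrite /= oppr0 addr0.
  by congr (_, _); rewrite /= add0r oppr0 addr0.
move=> H a b [an b2 bab].
have amod k : a ^+ (k %% m.+1) = a ^+ k.
  by rewrite [in RHS](divn_eq k m.+1) mulnC expgD expgM an expg1n mul1g.
have ba k : b * a ^+ k = a ^- k * b.
  have bb : b * b = 1 by rewrite -b2.
  elim: k => [|k IH]; first by rewrite expg0 invg1 mul1g mulg1.
  rewrite expgSr mulgA IH -mulgA.
  have -> : b * a = a^-1 * b by rewrite -bab -mulgA bb mulg1.
  by rewrite mulgA -invMg -expgS expgSr.
have aN (j : 'I_m.+1) : a ^+ (- j)%R = a ^- j.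
  rewrite /= amod; apply: (mulIg (a ^+ j)); rewrite mulVg -expgD subnK ?an //.
  exact: ltnW.
pose f (x : G) : H := a ^+ x.1 * b ^+ x.2.
have fM : {morph f : x y / x * y}.
  move=> [i c] [j d]; rewrite /f /= amod expgD -!mulgA; congr (_ * _).
  case: c => /=; last by rewrite mul1g.
  rewrite mulgA expg1 ba aN -mulgA; congr (_ * _).
  by case: d; rewrite //= ?mulg1 // -b2.
pose F : {multiplicative G -> H} :=
  HB.pack f (isMultiplicative.Build G H f fM).
exists F; split; rewrite /= /f /= ?amod ?expg1 ?mulg1 ?mul1g //.
Qed.

(* Main.v *)
From HB Require Import structures.
Require Import Defs.
From mathcomp Require Import all_boot all_order all_algebra all_fingroup.
From mathcomp Require Import boolp.

Set Implicit Arguments.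
Unset Strict Implicit.
Unset Printing Implicit Defensive.

Import GRing.Theory.

(** The Bowen-Franks group of a digraph is the abelian group generated by its
    vertices, where each vertex equals the sum of the sources of its incoming
    edges.  For the Cayley graph of [<s, t>] this reads
    [h = h s^-1 + h t^-1].  When [t] is an involution inverting [s], comparing
    the relations at [h s] and [h t] gives [h t = h s], and the relation at
    [h s] becomes the recurrence [h s^2 = h s - h].  So two classes, those of
    [1] and [s], generate the group, and right multiplication by [s] acts as a
    root [w] of [x^2 - x + 1], a primitive sixth root of unity: the group is
    [Z[w] / (w^n - 1)].  Since [w^6 = 1] and [w^n = 1] there, [w^d = 1] with
    [d = gcd(n, 6)].  For [d = 1] this gives [w = 1], hence [1 = 0]; for
    [d = 2] it gives [w = 2] and [3 = 0]; for [d = 3], where [w^3 = -1], it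
    gives [2 = 0].

    These relations bound the group from above ([bowen_franks_span] and the
    [period] lemmas).  To see that nothing more collapses one needs maps onto
    [Z/3] and [(Z/2)^2].  They come from the universal property of the dihedral
    group ([bowen_franks_map]): if [s] and [t] act on a group [V] by
    automorphisms [alpha], [tau], and [alpha u + tau u = u], then
    [h |-> h^-1 u] satisfies the vertex relations.  For [Z/3] both generators
    act by [-1]; for [(Z/2)^2], seen as the field of four elements, [s] acts
    with order three and [t] by a swap. *)

(** * Bowen-Franks groups by generators and relations *)

Section Presentation.
Local Open Scope ring_scope.
Local Open Scope quotient_scope.
Variable X : digraph.
Local Notation Q := (Quotient.quot (im_mx (1%:M - adjacency X))).

Definition incoming_relations (V : zmodType) (b : vertex X -> V) : Prop :=
  forall w, b w = \sum_(e : edge X | target e == w) b (source e).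

(** Every additive map out of [Z^N] has this form, [b] listing the images of
    the basis. *)
Definition pairing (V : zmodType) (b : vertex X -> V)
    (v : 'cV[int]_#|vertex X|) : V :=
  \sum_i b (enum_val i) *~ v i 0.

Lemma pairingD (V : zmodType) b : {morph @pairing V b : u v / u + v}.
Proof.
by move=> u v; rewrite -big_split; apply: eq_bigr => i _; rewrite mxE mulrzDr.
Qed.

Lemma pairingN (V : zmodType) b : {morph @pairing V b : v / - v}.
Proof.
by move=> v; rewrite -sumrN; apply: eq_bigr => i _; rewrite mxE mulrNz.
Qed.

(** Column [j] of [A] counts, source by source, the edges entering [j], so [b]
    pairs with column [j] of [1 - A] to the defect of [b] in the relation at
    [j].  This one computation yields both the relations in the quotient and
    the existence of maps out of it. *)
Lemma pairing_relation (V : zmodType) (b : vertex X -> V)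
    (w : 'cV[int]_#|vertex X|) :
  pairing b ((1%:M - adjacency X) *m w) =
  \sum_j (b (enum_val j)
     - \sum_(e : edge X | target e == enum_val j) b (source e)) *~ w j 0.
Proof.
have cols j : \sum_(e : edge X | target e == enum_val j) b (source e)
    = \sum_i b (enum_val i) *~ adjacency X i j.
  rewrite (partition_big (fun e => enum_rank (source e)) xpredT) //=.
  apply: eq_bigr => i _; rewrite mxE -pmulrn -sumr_const.
  apply: eq_big => [e|e /andP[_ /eqP <-]]; last by rewrite enum_rankK.
  by rewrite inE andbC (can2_eq (@enum_rankK _) (@enum_valK _)).
rewrite mulmxBl mul1mx pairingD pairingN.
under [RHS]eq_bigr do rewrite mulrzBl.
rewrite big_split sumrN; congr (_ - _).
under [RHS]eq_bigr do rewrite cols mulrz_suml.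
rewrite exchange_big; apply: eq_bigr => i _; rewrite mxE mulrz_sumr.
by apply: eq_bigr => j _; rewrite mulrzA.
Qed.

Lemma sum_mulrz_delta (V : zmodType) m (F : 'I_m -> V) i :
  \sum_j F j *~ (delta_mx i 0 : 'cV[int]_m) j 0 = F i.
Proof.
rewrite (bigD1 i) //= big1 ?addr0 => [|j ji]; first by rewrite mxE !eqxx mulr1z.
by rewrite mxE (negPf ji) mulr0z.
Qed.

Definition vertex_class (w : vertex X) : bowen_franks X :=
  \pi_Q (delta_mx (enum_rank w) 0).

Lemma pi_pairing (v : 'cV[int]_#|vertex X|) :
  \pi_Q v = pairing vertex_class v.
Proof.
rewrite [in LHS](matrix_sum_delta v) raddf_sum; apply: eq_bigr => i _.
rewrite big_ord1 -[v i 0 in LHS]intz scaler_int raddfMz.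
by rewrite /vertex_class enum_valK.
Qed.

Lemma pi_im_mx (v w : 'cV[int]_#|vertex X|) :
  v = (1%:M - adjacency X) *m w -> \pi_Q v = 0.
Proof.
move=> vE; rewrite -[RHS](raddf0 (\pi_Q)).
apply/eqP; rewrite -Quotient.idealrBE subr0.
by apply/asboolP; exists w.
Qed.

(** The defect at [w] is the class of the column of [1 - A] indexed by [w],
    which lies in the image. *)
Lemma vertex_class_incoming : incoming_relations vertex_class.
Proof.
move=> w; apply/eqP; rewrite -subr_eq0; apply/eqP.
pose d : 'cV[int]_#|vertex X| := delta_mx (enum_rank w) 0.
have := @pi_im_mx _ d erefl; rewrite pi_pairing pairing_relation.
by rewrite sum_mulrz_delta enum_rankK.
Qed.

Lemma vertex_class_ind (P : bowen_franks X -> Prop) :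
  P 0 -> (forall x y, P x -> P y -> P (x + y)) ->
  (forall w (k : int), P (vertex_class w *~ k)) -> forall x, P x.
Proof.
move=> P0 PD Pw x; rewrite -[x](@reprK _ Q) pi_pairing.
by apply: big_ind => // i _; apply: Pw.
Qed.

(** Together with [vertex_class_incoming] and [vertex_class_ind], this says that
    the vertices and their incoming relations present the group. *)
Lemma bowen_franks_universal (V : zmodType) (b : vertex X -> V) :
  incoming_relations b ->
  exists f : {additive bowen_franks X -> V},
    forall w, f (vertex_class w) = b w.
Proof.
move=> brel.
pose f (x : bowen_franks X) := pairing b (generic_quotient.repr (x : Q)).
have f_pi v : f (\pi_Q v) = pairing b v.
  apply/eqP; rewrite -subr_eq0 -pairingN -pairingD; apply/eqP.
  have : generic_quotient.repr (\pi_Q v) - v \in im_mx (1%:M - adjacency X).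
    by rewrite Quotient.idealrBE reprK.
  move=> /asboolP[w ->]; rewrite pairing_relation big1 // => j _.
  by rewrite -brel subrr mul0rz.
have f_sub : zmod_morphism f.
  move=> x y; rewrite -[x](@reprK _ Q) -[y](@reprK _ Q) -raddfB !f_pi.
  by rewrite pairingD pairingN.
pose F : {additive bowen_franks X -> V} :=
  HB.pack f (GRing.isZmodMorphism.Build _ _ f f_sub).
exists F => w /=.
by rewrite f_pi /pairing sum_mulrz_delta enum_rankK.
Qed.

End Presentation.

(** The edge labelled [x] that enters [h] starts at [h x^-1]. *)
Lemma cayley_incoming (gT : finGroupType) (S : {set gT}) (V : zmodType)
    (b : gT -> V) :
  incoming_relations (X := cayley_digraph S) b <->
  forall h, b h = (\sum_(x in S) b (h * x^-1)%g)%R.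
Proof.
suff E h : (\sum_(e : edge (cayley_digraph S) | target e == h) b (source e)
    = \sum_(x in S) b (h * x^-1)%g)%R.
  by split=> brel h; rewrite brel E.
rewrite [RHS]big_sub /=.
rewrite (partition_big (fun e : edge (cayley_digraph S) => e.2) xpredT) //=.
apply: eq_bigr => x _; rewrite (big_pred1 ((h * (val x)^-1)%g, x)) // => -[g y].
rewrite /= xpair_eqE; case: (y =P x) => [->|]; last by rewrite !andbF.
by rewrite !andbT (can2_eq (mulgK _) (mulgKV _)).
Qed.

Lemma zmod_isogP (A B : zmodType) (f : {additive A -> B}) :
  (forall x, f x = 0%R -> x = 0%R) -> (forall y, exists x, f x = y) ->
  zmod_isog A B.
Proof.
move=> f0 fsurj; exists f.
have fsurjb y : exists x, f x == y by have [x <-] := fsurj y; exists x.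
pose g y := xchoose (fsurjb y); have gK : cancel g f.
  by move=> y; apply/eqP; exact: (xchooseP (fsurjb y)).
exists g => // x; apply/eqP; rewrite -subr_eq0; apply/eqP/f0.
by rewrite raddfB gK subrr.
Qed.

(** * The relations of the dihedral Cayley graph *)

Section DihedralRelations.
Variables (gT : finGroupType) (s t : gT) (V : zmodType) (b : gT -> V).
Hypotheses (t2 : (t ^+ 2 = 1)%g) (tst : (t * s * t = s^-1)%g).
Hypothesis brel : forall h, b h = (b (h * s^-1)%g + b (h * t^-1)%g)%R.
Local Open Scope group_scope.

Let tV : t^-1 = t.
Proof. by apply: (mulgI t); rewrite mulgV -expg2. Qed.

Let st : t * s^-1 = s * t.
Proof. by rewrite -tst !mulgA -expg2 t2 mul1g. Qed.

(** Since [h t s^-1 = h s t], the relations at [h t] and at [h s] have the same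
    two terms on the right. *)
Lemma relation_swap h : b (h * t) = b (h * s).
Proof.
have := brel (h * t); rewrite tV -!mulgA -expg2 t2 mulg1 st mulgA => ->.
have := brel (h * s); rewrite tV mulgK => ->.
by rewrite addrC.
Qed.

(** This is the equation [x^2 = x - 1] of the primitive sixth roots of unity,
    for right multiplication by [s]. *)
Lemma relation_recurrence h : b (h * s * s) = (b (h * s) - b h)%R.
Proof.
by rewrite [in RHS](brel (h * s)) mulgK tV addrAC subrr add0r relation_swap.
Qed.

Lemma relation_s2 h : b (h * s ^+ 2) = (b (h * s) - b h)%R.
Proof. by rewrite expg2 mulgA relation_recurrence. Qed.

Lemma relation_s3 h : b (h * s ^+ 3) = (- b h)%R.
Proof.
by rewrite !expgS mulg1 !mulgA !relation_recurrence addrAC subrr add0r.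
Qed.

Definition period k := forall h, b (h * s ^+ k) = b h.

Lemma periodM k l : period k -> period (l * k).
Proof.
move=> pk h; rewrite mulnC expgM.
elim: l h => [|l IH] h; first by rewrite mulg1.
by rewrite expgS mulgA IH pk.
Qed.

Lemma period_gcd k l : 0 < k -> period k -> period l -> period (gcdn k l).
Proof.
move=> k0 pk pl h; have [u v E _] := egcdnP l k0.
by rewrite -(periodM u pk h) E addnC expgD mulgA (periodM v pl).
Qed.

Lemma period6 : period 6.
Proof. by move=> h; rewrite (expgD s 3 3) mulgA !relation_s3 opprK. Qed.

Lemma period1_trivial h : period 1 -> b h = 0%R.
Proof.
move=> p1; have := relation_s2 h; rewrite (periodM 2 p1) -[s]expg1 p1.
by rewrite subrr.
Qed.

Lemma period2_double h : period 2 -> b (h * s) = (b h *+ 2)%R.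
Proof.
by move=> /(_ h); rewrite relation_s2 => /eqP; rewrite subr_eq => /eqP.
Qed.

Lemma period2_torsion h : period 2 -> (b h *+ 3 = 0)%R.
Proof.
move=> p2; have := p2 h; rewrite expg2 mulgA !period2_double // -mulrnA.
by rewrite mulrS -{3}[b h]addr0 => /addrI.
Qed.

Lemma period3_torsion h : period 3 -> (b h *+ 2 = 0)%R.
Proof. by move=> /(_ h); rewrite relation_s3 mulr2n => {1}<-; rewrite addNr. Qed.

Hypothesis st_gen : <<[set s; t]>> = [set: gT].

(** Right multiplication by [s] or [t] preserves the property that both [b h]
    and [b (h * s)] lie in the span: for [s] by the recurrence, and for [t]
    because [t s = s^-1 t] turns [b (h t s)] into [b h]. *)
Lemma relation_span h :
  exists i j : int, b h = (b 1%g *~ i + b s *~ j)%R.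
Proof.
pose span x := exists i j : int, x = (b 1%g *~ i + b s *~ j)%R.
have span_s h' : span (b h') /\ span (b (h' * s)) ->
    span (b (h' * s)) /\ span (b (h' * s * s)).
  move=> [[i [j E]] [k [l F]]]; split; first by exists k, l.
  exists (k - i)%R, (l - j)%R; rewrite relation_recurrence E F !mulrzBr.
  by rewrite opprD addrACA.
have span_t h' : span (b h') /\ span (b (h' * s)) ->
    span (b (h' * t)) /\ span (b (h' * t * s)).
  rewrite relation_swap => -[? ?]; split=> //.
  have -> : h' * t * s = h' * s^-1 * t.
    by rewrite -!mulgA -tst -!mulgA -expg2 t2 mulg1.
  by rewrite relation_swap mulgKV.
suff: span (b h) /\ span (b (h * s)) by case.
(* As the group is finite, its elements are products of generators, without
   inverses. *)
have: h \in <<[set s; t]>> by rewrite st_gen inE.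
case/gen_prodgP => m [c cst ->].
elim: m c cst => [|m IH] c cst.
  rewrite big_ord0 mul1g; split; first by exists 1%R, 0%R; rewrite addr0.
  by exists 0%R, 1%R; rewrite add0r.
rewrite big_ord_recr /=.
have := IH (fun i => c (widen_ord (leqnSn m) i)) (fun i => cst _).
by move: (cst ord_max) => /set2P[] -> /=; [apply: span_s | apply: span_t].
Qed.

End DihedralRelations.

(** * Maps out of the Bowen-Franks group of the dihedral Cayley graph *)

Section DihedralMaps.
Variables (n : nat) (gT : finGroupType) (s t : gT).
Hypothesis pres : dihedral_presentation n s t.
Local Open Scope group_scope.
Notation X := (cayley_digraph [set s; t]).
Notation q := (@vertex_class X).

(** The determinant, [s |-> 1] and [t |-> -1], separates the generators for all
    [n], so the set [[set s; t]] always carries two edges per vertex. *)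
Lemma dihedral_gens_neq : s != t.
Proof.
(* [{perm bool}] stands for the group of signs. *)
case: pres => _ _ /(_ {perm bool} 1 (tperm true false)).
case=> [|f [fs ft]]; first split.
- by rewrite expg1n.
- by rewrite expg2 tperm2.
- by rewrite mulg1 tperm2 invg1.
apply/eqP=> st; move: ft; rewrite -st fs => /permP/(_ true).
by rewrite perm1 tpermL.
Qed.

Lemma dihedral_incoming (V : zmodType) (b : gT -> V) :
  incoming_relations (X := X) b <->
  forall h, b h = (b (h * s^-1)%g + b (h * t^-1)%g)%R.
Proof.
have E h : (\sum_(x in [set s; t]) b (h * x^-1)%g =
    b (h * s^-1)%g + b (h * t^-1)%g)%R.
  by rewrite big_setU1 ?inE ?dihedral_gens_neq //= big_set1.
by split=> [/cayley_incoming|] brel; [|apply/cayley_incoming];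
  move=> h; rewrite brel E.
Qed.

Lemma class_relation h : q h = (q (h * s^-1)%g + q (h * t^-1)%g)%R.
Proof. by apply/dihedral_incoming: h; apply: vertex_class_incoming. Qed.

(** The recurrence has period 6 and [s^n = 1] gives period [n]. *)
Lemma class_period : 0 < n -> period s q (gcdn n 6).
Proof.
case: pres => _ [sn t2 tst] _ n0; apply: period_gcd => //.
  by move=> h; rewrite sn mulg1.
exact: period6 t2 tst class_relation.
Qed.

Lemma bowen_franks_span (x : bowen_franks X) :
  exists i j : int, x = (q 1%g *~ i + q s *~ j)%R.
Proof.
case: pres => gen [_ t2 tst] _.
elim/vertex_class_ind: x => [|x y [i [j ->]] [k [l ->]]|h k].
- by exists 0%R, 0%R; rewrite addr0.
- by exists (i + k)%R, (j + l)%R; rewrite !mulrzDr addrACA.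
have [i [j ->]] := relation_span t2 tst class_relation gen h.
by exists (i * k)%R, (j * k)%R; rewrite mulrzDl !mulrzA.
Qed.

(** Permutations compose from left to right, so [h |-> f h^-1 u] is the orbit
    map of [u] under the corresponding left action.  Its relation at [h] is
    [alpha u + tau u = u] moved by the additive permutation [f h^-1]. *)
Lemma bowen_franks_map (V : finZmodType) (alpha tau : {perm V}) (u : V) :
  dihedral_rel n alpha tau ->
  {morph alpha : x y / (x + y)%R} -> {morph tau : x y / (x + y)%R} ->
  (alpha u + tau u = u)%R ->
  exists f : {additive bowen_franks X -> V},
    f (q 1) = u /\ f (q s) = (alpha^-1) u.
Proof.
move=> rel alphaD tauD uE; case: pres => gen [_ t2 _] /(_ _ _ _ rel)[f [fs ft]].
have f1 : f 1 = 1 by apply: (mulgI (f 1)); rewrite -gmulfM !mulg1.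
have fsV : f s^-1 = alpha^-1.
  by apply: (mulgI alpha); rewrite -{1}fs -gmulfM !mulgV.
have fD h : {morph f h : x y / (x + y)%R}.
  have : h \in <<[set s; t]>> by rewrite gen inE.
  case/gen_prodgP => m [c cst ->].
  elim: m c cst => [|m IH] c cst x y.
    by rewrite big_ord0 f1 !perm1.
  rewrite big_ord_recl gmulfM !permM.
  rewrite -(IH (fun i => c (lift ord0 i)) (fun i => cst _)); congr (f _ _).
  by case/set2P: (cst ord0) => ->; rewrite ?fs ?ft.
have brel h : f h^-1 u = (f (h * s^-1)^-1%g u + f (h * t^-1)^-1%g u)%R.
  by rewrite !invMg !invgK !gmulfM !permM -fD fs ft uE.
have [g gE] := bowen_franks_universal
  (iffRL (dihedral_incoming (fun h => f h^-1 u)) brel).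
exists g; rewrite !gE; split; first by rewrite invg1 f1 perm1.
by rewrite fsV.
Qed.

End DihedralMaps.

(** * The three residue classes *)

Lemma expg_dvd (H : groupType) (a : H) d n :
  d %| n -> (a ^+ d = 1 -> a ^+ n = 1)%g.
Proof. by case/dvdnP=> k -> ad; rewrite mulnC expgM ad expg1n. Qed.

Lemma gcdn6_modz n (r : int) :
  (n%:Z = r %[mod 6])%Z -> gcdn n 6 = gcdn `|r| 6.
Proof.
by move=> nr; have := gcdz_modl n 6; rewrite nr gcdz_modl => -[].
Qed.

Section Cases.
Variables (n : nat) (gT : finGroupType) (s t : gT).
Hypotheses (n_gt0 : 0 < n) (pres : dihedral_presentation n s t).
Local Open Scope ring_scope.
Notation X := (cayley_digraph [set s; t]).
Notation q := (@vertex_class X).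

Let t2 : (t ^+ 2 = 1)%g. Proof. by case: pres => _ []. Qed.
Let tst : (t * s * t = s^-1)%g. Proof. by case: pres => _ []. Qed.

Lemma bowen_franks_gcd1 : gcdn n 6 = 1%N -> zmod_isog (bowen_franks X) 'I_1.
Proof.
move=> d1; have p1 : period s q 1 by rewrite -d1; apply: (class_period pres).
apply: (@zmod_isogP _ _ \0) => [x _|y]; last by exists 0; rewrite [y]ord1.
have [i [j ->]] := bowen_franks_span pres x.
by rewrite !(period1_trivial t2 tst (class_relation pres)) // !mul0rz addr0.
Qed.

(** The span is cyclic, generated by [q 1] of order dividing 3, and the map to
    [Z/3] sends [q 1] to 1. *)
Lemma bowen_franks_gcd2 : gcdn n 6 = 2%N -> zmod_isog (bowen_franks X) 'Z_3.
Proof.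
move=> d2; have p2 : period s q 2 by rewrite -d2; apply: (class_period pres).
have oppK : involutive (-%R : 'Z_3 -> 'Z_3) := @opprK _.
pose alpha : {perm 'Z_3} := perm (inv_inj oppK).
have alpha2 : (alpha ^+ 2 = 1)%g.
  by apply/permP => x; rewrite expg2 permM !permE opprK.
have alphaV : (alpha^-1 = alpha)%g.
  by apply: (mulgI alpha); rewrite mulgV -expg2.
have alphaD : {morph alpha : x y / x + y} by move=> x y; rewrite !permE opprD.
have rel : dihedral_rel n alpha alpha.
  split=> //; last by rewrite -expg2 alpha2 mul1g alphaV.
  by apply: (expg_dvd _ alpha2); rewrite -d2 dvdn_gcdl.
(* The condition on [u] is [-1 - 1 = 1] modulo 3. *)
have [|f [f1 _]] := bowen_franks_map pres rel alphaD alphaD (u := 1).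
  by rewrite !permE; apply: val_inj.
apply: (zmod_isogP (f := f)) => [x|y]; last first.
  by exists (q 1%g *+ y); rewrite raddfMn f1; apply: natr_Zp.
have [i [j ->]] := bowen_franks_span pres x.
have := period2_double t2 tst (class_relation pres) 1%g p2.
rewrite mul1g => ->; rewrite pmulrn -mulrzA -mulrzDr raddfMz f1 => /eqP.
have ch3 : 3%N \in [pchar 'Z_3] by [].
rewrite -(dvdz_pcharf ch3) => /dvdzP[k ->].
rewrite mulrC mulrzA -pmulrn.
by rewrite (period2_torsion t2 tst (class_relation pres)) // mul0rz.
Qed.

(** [q 1] and [q s] have order dividing 2, and the map to [(Z/2)^2] sends them
    to the standard basis. *)
Lemma bowen_franks_gcd3 :
  gcdn n 6 = 3%N -> zmod_isog (bowen_franks X) ('Z_2 * 'Z_2)%type.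
Proof.
move=> d3; have p3 : period s q 3 by rewrite -d3; apply: (class_period pres).
(* [w] is multiplication by an element of order three in the field of four
   elements, in the basis where [u = (1, 0)] and [w^-1 u = (0, 1)]. *)
pose V : finZmodType := HB.pack_for finZmodType ('Z_2 * 'Z_2)%type.
pose w (x : V) : V := (x.1 + x.2, x.1).
have ch2 : 2%N \in [pchar 'Z_2] by [].
have Vrr (a : 'Z_2) : a + a = 0 by rewrite -mulr2n mulrn_pchar.
have w_inj : injective w.
  move=> [a b] [c d] E; have /= ac := congr1 snd E; have /= := congr1 fst E.
  by rewrite ac => /addrI ->.
have swapK : involutive (fun x : V => (x.2, x.1) : V) by case.
pose alpha : {perm V} := perm w_inj.
pose tau : {perm V} := perm (inv_inj swapK).
have alphaD : {morph alpha : x y / x + y}.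
  by move=> x y; rewrite !permE; congr (_, _); rewrite addrACA.
have tauD : {morph tau : x y / x + y} by move=> x y; rewrite !permE.
have alpha3 : (alpha ^+ 3 = 1)%g.
  apply/permP => -[a b]; rewrite !expgS mulg1 !permM !permE /w /=.
  by rewrite [a + b + a]addrAC Vrr add0r addrCA Vrr addr0.
have tau2 : (tau ^+ 2 = 1)%g.
  by apply/permP => x; rewrite expg2 permM !permE; case: x.
have rel : dihedral_rel n alpha tau.
  split=> //; first by apply: (expg_dvd _ alpha3); rewrite -d3 dvdn_gcdl.
  apply: (mulgI alpha); rewrite mulgV; apply/permP => -[a b].
  by rewrite !permM !permE /w /=; congr (_, _); rewrite addrA Vrr add0r.
have [|f [f1 fs]] := bowen_franks_map pres rel alphaD tauD (u := (1, 0) : V).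
  by rewrite !permE; congr (_, _); apply: val_inj.
have {}fs : f (q s) = (0, 1).
  rewrite fs; apply: (canLR (permK _)); rewrite permE.
  by congr (_, _); apply: val_inj.
have fE (i j : int) : f (q 1%g *~ i + q s *~ j) = (i%:~R, j%:~R).
  rewrite raddfD !raddfMz f1 fs [LHS]surjective_pairing.
  rewrite (raddfD fst) (raddfD snd) !(raddfMz fst) !(raddfMz snd) /=.
  by rewrite !mul0rz addr0 add0r.
apply: (zmod_isogP (f := f)) => [x|[a b]]; last first.
  exists (q 1%g *~ a%:Z + q s *~ b%:Z); rewrite fE -!pmulrn.
  by congr (_, _); apply: natr_Zp.
have [i [j ->]] := bowen_franks_span pres x.
rewrite fE => E; have /eqP := congr1 fst E; have /eqP := congr1 snd E.
rewrite /= -!(dvdz_pcharf ch2) => /dvdzP[k ->] /dvdzP[l ->].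
have q2 h : q h *~ 2 = 0.
  by rewrite -pmulrn (period3_torsion t2 tst (class_relation pres)).
by rewrite ![_ * 2%:Z]mulrC !mulrzA !q2 !mul0rz addr0.
Qed.

End Cases.

Theorem proposition3p4 (n : nat) (gT : finGroupType) (s t : gT) :
  0 < n -> ~~ (6 %| n) -> dihedral_presentation n s t ->
  let X := cayley_digraph [set s; t] in
  [/\ (n%:Z = 1 %[mod 6])%Z \/ (n%:Z = -1 %[mod 6])%Z ->
        zmod_isog (bowen_franks X) 'I_1,
      (n%:Z = 2 %[mod 6])%Z \/ (n%:Z = -2 %[mod 6])%Z ->
        zmod_isog (bowen_franks X) 'Z_3
    & (n%:Z = 3 %[mod 6])%Z ->
        zmod_isog (bowen_franks X) ('Z_2 * 'Z_2)%type].
Proof.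
move=> n_gt0 _ pres X; split=> [nr|nr|/gcdn6_modz nr].
- by apply: (bowen_franks_gcd1 n_gt0 pres); case: nr => /gcdn6_modz.
- by apply: (bowen_franks_gcd2 n_gt0 pres); case: nr => /gcdn6_modz.
- exact: (bowen_franks_gcd3 n_gt0 pres).
Qed.
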